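(* Let $d\geq 3$ be an integer and let $G$ be a connected non-bipartite $d$-regular graph. Let $\lambda_{2}(G)$ denote the second largest eigenvalue of the adjacency matrix of $G$. If $$\lambda_{2}(G)\leq\frac{\sqrt{1+4(d-1)^{2}}-1}{2},$$ then $t(G)>1$ unless $G$ is (isomorphic to) the graph $G_{d}$, where $t(G)$ is the toughness of $G$ and $G_{d}$ is the graph of order $3d-1$ defined in the context.
   Context: All graphs are finite, undirected and without loops or multiple edges. The eigenvalues of a graph $G$ of order $n$ are the eigenvalues of its adjacency matrix, listed with multiplicity as $\lambda_{1}(G)\geq\lambda_{2}(G)\geq\cdots\geq\lambda_{n}(G)$. Toughness: for a graph $H$ let $c(H)$ be the number of connected components of $H$, and for $S\subseteq V(G)$ let $G-S$ be the subgraph of $G$ induced by $V(G)\setminus S$. The toughness of $G$ is $$t(G)=\min\left\{\frac{|S|}{c(G-S)}\right\},$$ where the minimum is over all proper subsets $S\subset V(G)$ such that $c(G-S)\geq 2$. If there is no such $S$ (i.e. $G$ is complete), then $t(G)=+\infty$. The graph $G_{d}$ ($d\geq 3$): let $K_{m}$ be the complete graph on $m$ vertices and $\overline{K_{m}}$ its complement (the edgeless graph on $m$ vertices). $G_{d}$ is obtained from the disjoint union of $\overline{K_{d}}$, $\overline{K_{d-1}}$ and $K_{d}$ by joining every vertex of $\overline{K_{d}}$ to every vertex of $\overline{K_{d-1}}$, and adding a perfect matching ($d$ pairwise disjoint edges) between $V(\overline{K_{d}})$ and $V(K_{d})$. *)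

(* Defs.v *)
From HB Require Import structures.
From mathcomp Require Import all_boot all_order all_algebra.
From mathcomp Require Import polyrcf constructive_ereal.

Set Implicit Arguments.
Unset Strict Implicit.
Unset Printing Implicit Defensive.

Import Order.TTheory GRing.Theory Num.Theory.
Local Open Scope ring_scope.

Record sgraph := SGraph {
  vertex :> finType;
  adj : rel vertex;
  adj_sym : symmetric adj;
  adj_irrefl : irreflexive adj
}.

Definition isomorphic (G H : sgraph) : Prop :=
  exists2 f : G -> H, bijective f & {mono f : x y / adj x y}.

Definition regular (d : nat) (G : sgraph) : Prop :=
  forall x : G, #|[set y | adj x y]| = d.

Definition bipartite (G : sgraph) : Prop :=
  exists A : {set G}, forall x y : G, adj x y -> (x \in A) != (y \in A).

Definition num_comp (G : sgraph) : nat := n_comp (@adj G) [set: G].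

(* In particular, a connected graph has at least one vertex. *)
Definition connected (G : sgraph) : Prop := num_comp G = 1%N.

Section Induced.
Variables (G : sgraph) (A : {set G}).

Definition induced_adj : rel {x : G | x \in A} :=
  fun x y => adj (val x) (val y).

Lemma induced_adj_sym : symmetric induced_adj.
Proof. by move=> x y; exact: adj_sym. Qed.

Lemma induced_adj_irrefl : irreflexive induced_adj.
Proof. by move=> x; exact: adj_irrefl. Qed.

Definition induced : sgraph := SGraph induced_adj_sym induced_adj_irrefl.

End Induced.

(* [c(G - S)] *)
Definition num_comp_del (G : sgraph) (S : {set G}) : nat :=
  num_comp (induced (~: S)).

(* The neutral element +oo is the value when no S disconnects G. *)
Definition toughness (G : sgraph) : \bar rat :=
  \big[Order.min/+oo%E]_(S : {set G} |
      (S \proper [set: G]) && (2 <= num_comp_del S)%N)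
    (#|S|%:R / (num_comp_del S)%:R)%:E.

Definition adjmx (R : nzRingType) (G : sgraph) : 'M[R]_#|G| :=
  \matrix_(i, j) (adj (enum_val i) (enum_val j))%:R.

(* The roots in R of the characteristic polynomial, each repeated according to
   its multiplicity, in nonincreasing order. For a symmetric matrix A of size n
   this list has length n. *)
Definition spectrum (R : rcfType) (n : nat) (A : 'M[R]_n) : seq R :=
  sort >=%R
    (flatten [seq nseq (mup a (char_poly A)) a | a <- rootsR (char_poly A)]).

(* [eigval R G k] is the k-th largest adjacency eigenvalue, for 1 <= k <= #|G|. *)
Definition eigval (R : rcfType) (G : sgraph) (k : nat) : R :=
  (spectrum (adjmx R G))`_k.-1.

Section ExtremalGraph.
Variable d : nat.

(* The three summands are the vertex sets of the edgeless graph on d vertices,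
   the edgeless graph on d - 1 vertices and the complete graph on d vertices. *)
Definition Gd_vertex : finType := ('I_d + 'I_d.-1 + 'I_d)%type.

Definition Gd_adj : rel Gd_vertex := fun x y =>
  match x, y with
  | inl (inl _), inl (inr _) | inl (inr _), inl (inl _) => true
  | inr i, inr j => i != j
  | inl (inl i), inr j | inr j, inl (inl i) => i == j
  | _, _ => false
  end.

Lemma Gd_adj_sym : symmetric Gd_adj.
Proof. by move=> [[i|i]|i] [[j|j]|j] //=; rewrite eq_sym. Qed.

Lemma Gd_adj_irrefl : irreflexive Gd_adj.
Proof. by move=> [[i|i]|i] //=; rewrite eqxx. Qed.

Definition Gd : sgraph := SGraph Gd_adj_sym Gd_adj_irrefl.

End ExtremalGraph.

(* Main.v *)
Require Import Defs.
From mathcomp Require Import all_boot all_order all_algebra.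
From mathcomp Require Import polyrcf constructive_ereal.
From mathcomp Require Import complex spectral zify ring lra.

(** Write theta for the positive root of x ^ 2 + x = (d - 1) ^ 2, the bound on
lambda2; it is the second largest eigenvalue of G_d.  It satisfies
d - 3/2 < theta < d - 4/3.

Suppose that G - S has c >= 2 components and that |S| <= c.  For a component
D let e(D) be the number of edges from D to S.  A vertex of D has at most
|D| - 1 neighbours in D, so |D| (d + 1 - |D|) <= e(D); hence e(D) < d forces
|D| > d, and e(D) <= d forces |D| = 1 or |D| >= d.  The numbers e(D) add up to
at most d |S| <= d c.  If no component had e(D) <= d <= |D|, then all would be
single vertices sending exactly d edges to S, S would be independent, and G
bipartite ([exists_sparse_block]).  So there is a component D0 with
e(D0) <= d <= |D0|.

For a d-regular graph on N vertices with lambda2 < d the spectral theorem gives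
the Poincare inequality
  (d - lambda2) sum_{x, y} (f x - f y) ^ 2
     <= N sum_{x, y} a_{xy} (f x - f y) ^ 2     ([poincare_inequality]).
It is applied to functions with at most three values.

- Two disjoint non-adjacent sets cannot both have a boundary of at most 4/3
  edges per vertex ([disjoint_sparse_sets]).  Therefore every other component
  D has 3 e(D) > 4 |D|, so e(D) >= d.
- If some other D had two vertices or more, then e(D) > d, so e(D0) < d and
  |D0| > d, and counting leaves e(D0) <= 2 (d + 1) / 3.  The cut around D0 is
  then too sparse ([sparse_cut]).
- So all other components are single vertices, |S| = c, and the parts D0, S
  and the rest T have sizes |D0| >= d, |S| >= d, |T| = |S| - 1, with at most d
  edges between D0 and S and d |T| between S and T.  A function constant on
  the three parts gives |D0| = |S| = d ([extremal_tripartition]).  The degrees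
  then force the structure of G_d ([isomorphic_Gd]). *)

Set Implicit Arguments.
Unset Strict Implicit.
Unset Printing Implicit Defensive.

Import Order.TTheory GRing.Theory Num.Theory.
Local Open Scope ring_scope.

(** * Rayleigh quotients and the second largest eigenvalue *)

Section Spectral.
Local Open Scope complex_scope.
Local Open Scope sesquilinear_scope.

Lemma mup_prod_XsubC (F : fieldType) (s : seq F) (a : F) :
  mup a (\prod_(x <- s) ('X - x%:P)) = count_mem a s.
Proof.
elim: s => [|x s IHs]; first by rewrite big_nil mupNroot ?root1.
rewrite big_cons mupM ?polyXsubC_eq0 ?IHs //=; last first.
  by rewrite monic_neq0 // monic_prod_XsubC.
congr addn.
by have := mup_XsubCX 1 a x; rewrite expr1.
Qed.

(** Counting multiplicities: [spectrum] lists each root a of the product exactly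
[mup a] times, which is the number of occurrences of a in s. *)
Lemma spectrum_split (R : rcfType) (n : nat) (A : 'M[R]_n) (s : seq R) :
  char_poly A = \prod_(x <- s) ('X - x%:P) -> perm_eq (spectrum A) s.
Proof.
move=> charA; rewrite /spectrum perm_sort charA.
set p := \prod_(x <- s) _.
have p_neq0 : p != 0 by rewrite monic_neq0 // monic_prod_XsubC.
apply/allP => a _ /=; apply/eqP.
rewrite count_flatten -map_comp sumnE big_map.
rewrite (eq_bigr (fun b => if b == a then mup b p else 0%N)); last first.
  move=> b _ /=; rewrite count_nseq /=.
  by case: eqP => _; rewrite ?mul1n ?mul0n.
rewrite -[in RHS](mup_prod_XsubC s) -/p.
have := roots_on_rootsR p_neq0 a; rewrite in_itv /= => root_a.
have [a_root | a_nroot] := boolP (a \in rootsR p).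
  rewrite (bigD1_seq a) ?uniq_roots //= eqxx big1 ?addn0 // => b.
  by case: eqP.
rewrite mupNroot ?root_a // big1_seq // => b /= b_root.
by case: eqP b_root => [->|//]; rewrite (negPf a_nroot).
Qed.

Lemma char_poly_similar (F : fieldType) (n : nat) (P A : 'M[F]_n) :
  P \in unitmx -> char_poly (invmx P *m A *m P) = char_poly A.
Proof.
move=> unitP; rewrite /char_poly.
have -> : char_poly_mx (invmx P *m A *m P) =
    map_mx polyC (invmx P) *m char_poly_mx A *m map_mx polyC P.
  rewrite /char_poly_mx mulmxBr mulmxBl -!map_mxM; congr (_ - _).
  by rewrite scalar_mxC -mulmxA -map_mxM mulVmx // map_mx1 mulmx1.
rewrite !det_mulmx mulrAC -det_mulmx -map_mxM mulVmx //.
by rewrite map_mx1 det1 mul1r.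
Qed.

(** A real symmetric matrix is Hermitian over R[i], so it is unitarily
diagonalizable there with real eigenvalues; comparing characteristic
polynomials identifies these eigenvalues with the spectrum over R. *)
Lemma symmetric_diagonalization (R : rcfType) (n : nat) (A : 'M[R]_n) :
  A^T = A ->
  exists (P : 'M[R[i]]_n) (r : 'I_n -> R),
    [/\ P \is unitarymx,
        map_mx (real_complex R) A
          = P ^t* *m diag_mx (\row_j (r j)%:C) *m P
      & perm_eq (spectrum A) (codom r)].
Proof.
move=> symA; pose AC := map_mx (real_complex R) A.
have hermAC : AC \is hermsymmx.
  apply: realsym_hermsym.
    by apply/is_hermitianmxP; rewrite expr0 scale1r map_mx_id // map_trmx symA.
  apply/mxOverP => i j; rewrite mxE; apply/complex_realP; exists (A i j).
  by [].
have /orthomx_spectralP ACE := hermitian_normalmx hermAC.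
have := hermitian_spectral_diag_real hermAC.
set sp := spectral_diag AC in ACE *; set P := spectralmx AC in ACE *.
move=> real_sp.
pose r j := complex.Re (sp 0 j).
have spE : sp = \row_j (r j)%:C.
  apply/rowP => j; rewrite mxE /r; have := mxOverP real_sp 0 j.
  by move=> /complex_realP[x ->].
exists P, r; split; first exact: spectral_unitarymx.
  by rewrite -spE -invmx_unitary ?spectral_unitarymx.
apply: spectrum_split.
apply/eqP; rewrite -(inj_eq (map_poly_inj (real_complex R))); apply/eqP.
rewrite map_char_poly -/AC ACE char_poly_similar ?spectral_unit //.
rewrite char_poly_trig ?diag_mx_is_trig // rmorph_prod /= big_image /=.
apply: eq_bigr => j _.
by rewrite spE !mxE eqxx rmorphB /= map_polyX map_polyC.
Qed.

Lemma count_gt_second (R : rcfType) (s : seq R) :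
  sorted >=%R s -> (count (fun x => (s`_1 < x)%R) s <= 1)%N.
Proof.
case: s => [|a [|b s]] //= => [_|/andP[_ path_bs]]; first by case: (_ < _).
rewrite ltxx add0n; suff -> : count (fun x => b < x) s = 0%N by case: (_ < _).
apply/eqP; rewrite -leqn0 leqNgt -has_count; apply/hasPn => x x_s.
rewrite -leNgt; apply: (allP (order_path_min _ path_bs)) => //.
by move=> y z w; exact: (fun h k => le_trans k h).
Qed.

(** Injectivity in the index, not in the value: this excludes a double
eigenvalue above the second entry of the sorted list. *)
Lemma gt_second_unique (R : rcfType) (n : nat) (s : seq R) (r : 'I_n -> R) :
  perm_eq s (codom r) -> sorted >=%R s ->
  forall i j, s`_1 < r i -> s`_1 < r j -> i = j.
Proof.
move=> perm_r sorted_s i j lt_i lt_j; apply/eqP/negPn/negP => neq_ij.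
have := count_gt_second sorted_s; apply/negP; rewrite -ltnNge.
rewrite (permP perm_r) codomE count_map -size_filter.
rewrite (uniq_leq_size (s1 := [:: i; j])) //= ?inE ?neq_ij //.
move=> k; rewrite !inE mem_filter mem_enum /=.
by case/orP => /eqP->; rewrite ?lt_i ?lt_j.
Qed.

(** Were the form of A - t positive on both u and v, it would be positive
definite on their complex span, because u and v are orthogonal for the form.
But that plane contains a nonzero vector whose coordinate along the only eigenvector with
eigenvalue above t vanishes, and there the form is nonpositive. *)
Lemma orthogonal_pair_rayleigh (R : rcfType) (n : nat) (A : 'M[R]_n)
    (t : R) (P : 'M[R[i]]_n) (r : 'I_n -> R) (u v : 'rV[R]_n) :
  A^T = A -> P \is unitarymx ->
  map_mx (real_complex R) A = P ^t* *m diag_mx (\row_j (r j)%:C) *m P ->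
  (forall i j, t < r i -> t < r j -> i = j) ->
  u *m v^T = 0 -> u *m A *m v^T = 0 ->
  t * (u *m u^T) 0 0 < (u *m A *m u^T) 0 0 ->
  (v *m A *m v^T) 0 0 <= t * (v *m v^T) 0 0.
Proof.
move=> symA unitP diagA uniq_r uv0 uAv0 u_gt; rewrite leNgt; apply/negP => v_gt.
(* [co w] lists the coordinates of w in the eigenbasis, and [B] is the form of
   A - t in these coordinates. *)
pose co (w : 'rV[R]_n) : 'rV[R[i]]_n := map_mx (real_complex R) w *m P ^t*.
pose B (x y : 'rV[R[i]]_n) :=
  \sum_k (r k - t)%:C * (x 0 k * Num.conj (y 0 k)).
have conj_map (m p : nat) (M : 'M[R]_(m, p)) :
    map_mx Num.conj (map_mx (real_complex R) M) = map_mx (real_complex R) M.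
  apply/matrixP => a b; rewrite !mxE; apply/CrealP/complex_realP.
  by exists (M a b).
have unitP' : P ^t* *m P = 1%:M by apply/mulmx1C/unitarymxP.
have co_adj w' : (co w') ^t* = P *m map_mx (real_complex R) w'^T.
  by rewrite /co trmx_mul map_mxM /= trmxCK !map_trmx conj_map.
have coE w w' :
  ((w *m A *m w'^T) 0 0 - t * (w *m w'^T) 0 0)%:C = B (co w) (co w').
  have -> : ((w *m A *m w'^T) 0 0 - t * (w *m w'^T) 0 0)%:C =
     (co w *m diag_mx (\row_j (r j)%:C) *m (co w') ^t*) 0 0
     - t%:C * (co w *m (co w') ^t*) 0 0.
    have -> : co w *m diag_mx (\row_j (r j)%:C) *m (co w') ^t*
        = map_mx (real_complex R) (w *m A *m w'^T).
      by rewrite !map_mxM diagA co_adj /co !mulmxA.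
    have -> : co w *m (co w') ^t* = map_mx (real_complex R) (w *m w'^T).
      by rewrite co_adj /co !map_mxM mulmxA -[_ *m _ *m P]mulmxA unitP' mulmx1.
    by rewrite !mxE rmorphB rmorphM.
  rewrite [(co w *m _ *m _) 0 0]mxE [(co w *m (co w') ^t*) 0 0]mxE.
  rewrite mulr_sumr /B -sumrB; apply: eq_bigr => k _.
  rewrite mul_mx_diag !mxE rmorphB mulrBl.
  by rewrite mulrA [_ * (r k)%:C]mulrC !mulrA.
have Buv : B (co u) (co v) = 0.
  by rewrite -coE uv0 uAv0 !mxE mulr0 subr0.
have vu0 : v *m u^T = 0 by apply: trmx_inj; rewrite trmx_mul trmxK uv0 trmx0.
have vAu0 : v *m A *m u^T = 0.
  by apply: trmx_inj; rewrite -mulmxA !trmx_mul trmxK symA uAv0 trmx0.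
have Bvu : B (co v) (co u) = 0 by rewrite -coE vu0 vAu0 !mxE mulr0 subr0.
have Bu : 0 < B (co u) (co u) by rewrite -coE ltcR subr_gt0.
have Bv : 0 < B (co v) (co v) by rewrite -coE ltcR subr_gt0.
have B_le0 (x : 'rV[R[i]]_n) :
    (forall k, t < r k -> x 0 k = 0) -> B x x <= 0.
  move=> x0; apply: sumr_le0 => k _.
  have [/x0 ->|r_le] := ltP t (r k); first by rewrite !mul0r mulr0.
  by rewrite mulr_le0_ge0 ?mul_conjC_ge0 // lecR subr_le0.
have B_comb (a b : R[i]) (x y : 'rV[R[i]]_n) :
  B (a *: x - b *: y) (a *: x - b *: y) =
    a * Num.conj a * B x x + b * Num.conj b * B y y
    - (a * Num.conj b * B x y + b * Num.conj a * B y x).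
  rewrite /B !mulr_sumr -!big_split -!sumrB; apply: eq_bigr => k _ /=.
  rewrite !mxE (rmorphB Num.conj) !(rmorphM Num.conj) /=.
  move: (r k - t)%:C (Num.conj a) (Num.conj b) => m a' b'.
  move: (Num.conj (x 0 k)) (Num.conj (y 0 k)) => x' y'.
  ring.
have [i t_lt|r_le] := pickP (fun i => t < r i); last first.
  have : B (co u) (co u) <= 0 by apply: B_le0 => k; rewrite r_le.
  by rewrite (lt_geF Bu).
pose a := co v 0 i; pose b := co u 0 i.
have comb_i (x y : 'rV[R[i]]_n) : (y 0 i *: x - x 0 i *: y) 0 i = 0.
  by rewrite !mxE mulrC subrr.
have : B (a *: co u - b *: co v) (a *: co u - b *: co v) <= 0.
  by apply: B_le0 => k t_k; rewrite -(uniq_r _ _ t_lt t_k); exact: comb_i.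
rewrite B_comb Buv Bvu !mulr0 addr0 subr0 => B_comb_le0.
have b_eq0 : b = 0.
  apply/eqP/negPn/negP; rewrite -mul_conjC_gt0 => b_gt0.
  move: B_comb_le0; rewrite lt_geF // ltr_wpDl //.
    by rewrite mulr_ge0 ?mul_conjC_ge0 // ltW.
  exact: mulr_gt0.
have : B (co u) (co u) <= 0.
  by apply: B_le0 => k t_k; rewrite -(uniq_r _ _ t_lt t_k); exact: b_eq0.
by rewrite (lt_geF Bu).
Qed.

Lemma rayleigh_le_second (R : rcfType) (n : nat) (A : 'M[R]_n)
    (u v : 'rV[R]_n) :
  A^T = A -> u *m v^T = 0 -> u *m A *m v^T = 0 ->
  (spectrum A)`_1 * (u *m u^T) 0 0 < (u *m A *m u^T) 0 0 ->
  (v *m A *m v^T) 0 0 <= (spectrum A)`_1 * (v *m v^T) 0 0.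
Proof.
move=> symA.
have [P [r [unitP diagA perm_r]]] := symmetric_diagonalization symA.
apply: (orthogonal_pair_rayleigh symA unitP diagA).
by apply: gt_second_unique perm_r _; apply: sort_sorted => x y; exact: le_total.
Qed.

End Spectral.

(** * The Poincare inequality of a regular graph *)

Lemma sum_adj_regular (R : nzRingType) (d : nat) (G : sgraph) (x : G) :
  regular d G -> \sum_(y : G) (adj x y)%:R = d%:R :> R.
Proof.
move=> regG; rewrite -(regG x) -natr_sum; congr (_%:R).
rewrite -sum1_card [RHS]big_mkcond /=; apply: eq_bigr => y _.
by rewrite inE; case: adj.
Qed.

(** The Laplacian identity for symmetric weights with constant row sums. *)
Lemma sum_sqr_diff (R : comNzRingType) (T : finType) (w : T -> T -> R) (c : R)
    (f : T -> R) :
  (forall x y, w x y = w y x) -> (forall x, \sum_y w x y = c) ->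
  \sum_x \sum_y w x y * (f x - f y) ^+ 2 =
    2 * (c * (\sum_x f x ^+ 2) - \sum_x \sum_y w x y * (f x * f y)).
Proof.
move=> w_sym w_row.
have half : \sum_x \sum_y w x y * f x ^+ 2 = c * \sum_x f x ^+ 2.
  by rewrite mulr_sumr; apply: eq_bigr => x _; rewrite -mulr_suml w_row.
have half' : \sum_x \sum_y w x y * f y ^+ 2 = c * \sum_x f x ^+ 2.
  rewrite exchange_big -half; apply: eq_bigr => x _.
  by apply: eq_bigr => y _ /=; rewrite w_sym.
transitivity (\sum_x \sum_y w x y * f x ^+ 2 + \sum_x \sum_y w x y * f y ^+ 2
  - 2 * \sum_x \sum_y w x y * (f x * f y)); last by rewrite half half'; ring.
rewrite mulr_sumr -big_split -sumrB; apply: eq_bigr => x _ /=.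
rewrite mulr_sumr -big_split -sumrB; apply: eq_bigr => y _ /=; ring.
Qed.

Section AdjacencyForm.
Variables (R : rcfType) (d : nat) (G : sgraph).
Implicit Type f : G -> R.

Definition row_fun f : 'rV[R]_#|G| := \row_i f (enum_val i).

Lemma row_fun_dot f g :
  (row_fun f *m (row_fun g)^T) 0 0 = \sum_x f x * g x.
Proof.
rewrite mxE [RHS](reindex _ (onW_bij _ (@enum_val_bij G))) /=.
by apply: eq_bigr => i _; rewrite !mxE.
Qed.

Lemma row_fun_adjmx f g :
  (row_fun f *m adjmx R G *m (row_fun g)^T) 0 0
    = \sum_x \sum_y (adj x y)%:R * (f x * g y).
Proof.
rewrite -mulmxA mxE [RHS](reindex _ (onW_bij _ (@enum_val_bij G))) /=.
apply: eq_bigr => i _; rewrite !mxE mulr_sumr.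
rewrite [RHS](reindex _ (onW_bij _ (@enum_val_bij G))) /=.
by apply: eq_bigr => j _; rewrite !mxE mulrCA.
Qed.

Lemma adjmx_sym : (adjmx R G)^T = adjmx R G.
Proof. by apply/matrixP => i j; rewrite !mxE adj_sym. Qed.

Hypothesis regG : regular d G.
Hypothesis lambda2_lt : eigval R G 2 < d%:R.

(** The constant vector is an eigenvector for d > lambda2, so it takes up the
only eigenvalue that may exceed lambda2; f is orthogonal to it. *)
Lemma adjacency_form_le_lambda2 f :
  \sum_x f x = 0 ->
  \sum_x \sum_y (adj x y)%:R * (f x * f y)
    <= eigval R G 2 * \sum_x f x ^+ 2.
Proof.
move=> sum_f0.
have [x0 _ | G0] := pickP (@predT G); last first.
  by rewrite !big_pred0 ?mulr0.
have form1 (g : G -> R) :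
    \sum_x \sum_y (adj x y)%:R * (1 * g y) = d%:R * \sum_y g y :> R.
  rewrite exchange_big mulr_sumr; apply: eq_bigr => y _ /=.
  rewrite -mulr_suml mul1r -(sum_adj_regular _ y regG); congr (_ * _).
  by apply: eq_bigr => x _; rewrite adj_sym.
pose u := row_fun (fun=> 1); pose v := row_fun f.
have dim1 (M : 'M[R]_1) : M 0 0 = 0 -> M = 0.
  by move=> M0; apply/matrixP => i j; rewrite !ord1 M0 mxE.
have -> : \sum_x f x ^+ 2 = (v *m v^T) 0 0.
  by rewrite row_fun_dot; apply: eq_bigr.
rewrite -row_fun_adjmx; apply: (@rayleigh_le_second _ _ _ u) => //.
- exact: adjmx_sym.
- apply: dim1; rewrite row_fun_dot -[RHS]sum_f0.
  by apply: eq_bigr => x _; rewrite mul1r.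
- by apply: dim1; rewrite row_fun_adjmx form1 sum_f0 mulr0.
rewrite row_fun_adjmx row_fun_dot form1.
under [X in _ * X < _]eq_bigr do rewrite mulr1.
rewrite ltr_pM2r // sumr_const ltr0n; apply/card_gt0P; by exists x0.
Qed.

(** Both sides depend only on the differences of f, so f may be replaced by
N f - sum f, which has sum zero; the difference sums then reduce to the norm and
to the adjacency form. *)
Lemma poincare_inequality f :
  (d%:R - eigval R G 2) * (\sum_x \sum_y (f x - f y) ^+ 2)
    <= #|G|%:R * \sum_x \sum_y (adj x y)%:R * (f x - f y) ^+ 2.
Proof.
set N : R := #|G|%:R; pose m := \sum_x f x; pose g x := N * f x - m.
have sum_g0 : \sum_x g x = 0.
  by rewrite sumrB -mulr_sumr sumr_const -mulr_natl -/N subrr.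
have := adjacency_form_le_lambda2 sum_g0.
have adj_row (x : G) : \sum_y (adj x y)%:R = d%:R :> R.
  by apply: sum_adj_regular.
have adjC (x y : G) : (adj x y)%:R = (adj y x)%:R :> R by rewrite adj_sym.
have diff_g x y : (g x - g y) = N * (f x - f y) by rewrite /g; ring.
have := sum_sqr_diff g adjC adj_row.
have := sum_sqr_diff (w := fun _ _ => 1) (c := N) g (fun _ _ => erefl).
have -> : \sum_x \sum_y 1 * (g x * g y) = 0.
  by rewrite big1 // => x _; under eq_bigr do rewrite mul1r;
    rewrite -mulr_sumr sum_g0 mulr0.
have diff1 : \sum_x \sum_y 1 * (g x - g y) ^+ 2 =
    N ^+ 2 * \sum_x \sum_y (f x - f y) ^+ 2.
  rewrite mulr_sumr; apply: eq_bigr => x _; rewrite mulr_sumr.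
  by apply: eq_bigr => y _; rewrite diff_g mul1r exprMn.
have diff_adj : \sum_x \sum_y (adj x y)%:R * (g x - g y) ^+ 2 =
    N ^+ 2 * \sum_x \sum_y (adj x y)%:R * (f x - f y) ^+ 2.
  rewrite mulr_sumr; apply: eq_bigr => x _; rewrite mulr_sumr.
  by apply: eq_bigr => y _; rewrite diff_g exprMn mulrCA.
rewrite diff1 diff_adj => /(_ _)E1 E2 le_g.
have [x0 _ | G0] := pickP (@predT G); last by rewrite !big_pred0 // !mulr0.
have N_gt0 : 0 < N by rewrite ltr0n; apply/card_gt0P; exists x0.
have {}E1 := E1 (fun x => sumr_const _ _).
rewrite -(ler_pM2l (exprn_gt0 2 N_gt0)).
rewrite mulrCA E1 [leRHS]mulrCA E2 subr0; nra.
Qed.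

End AdjacencyForm.

Definition edges (G : sgraph) (A B : {set G}) : nat :=
  \sum_(x in A) \sum_(y in B) adj x y.

Lemma edgesC (G : sgraph) (A B : {set G}) : edges A B = edges B A.
Proof.
rewrite /edges exchange_big; apply: eq_bigr => y _.
by apply: eq_bigr => x _; rewrite adj_sym.
Qed.

Lemma sum_tripartition (V : nmodType) (T : finType) (A B : {set T})
    (F : T -> V) :
  [disjoint A & B] ->
  \sum_x F x =
    \sum_(x in A) F x + \sum_(x in B) F x + \sum_(x in ~: (A :|: B)) F x.
Proof.
move=> disjAB; rewrite (bigID [in A :|: B]) /=; congr (_ + _).
  by rewrite -bigU //; apply: eq_bigl => x; rewrite !inE.
by apply: eq_bigl => x; rewrite !inE.
Qed.

Lemma double_sum_step (R : comNzRingType) (T : finType) (w : T -> T -> R)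
    (A B : {set T}) (a b c : R) :
  [disjoint A & B] -> (forall x y, w x y = w y x) ->
  let f x := if x \in A then a else if x \in B then b else c in
  let C := ~: (A :|: B) in
  \sum_x \sum_y w x y * (f x - f y) ^+ 2 =
    2 * ((\sum_(x in A) \sum_(y in B) w x y) * (a - b) ^+ 2
       + (\sum_(x in B) \sum_(y in C) w x y) * (b - c) ^+ 2
       + (\sum_(x in A) \sum_(y in C) w x y) * (a - c) ^+ 2).
Proof.
move=> disjAB w_sym f C.
have fA x : x \in A -> f x = a by rewrite /f => ->.
have fB x : x \in B -> f x = b.
  by move=> xB; rewrite /f (disjointFl disjAB xB) xB.
have fC x : x \in C -> f x = c.
  by rewrite /f !inE negb_or => /andP[/negPf-> /negPf->].
pose W (X Y : {set T}) := \sum_(x in X) \sum_(y in Y) w x y.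
have W_sym X Y : W X Y = W Y X.
  rewrite /W exchange_big; apply: eq_bigr => x _; apply: eq_bigr => y _.
  exact: w_sym.
have block (X Y : {set T}) p q :
    (forall x, x \in X -> f x = p) -> (forall y, y \in Y -> f y = q) ->
    \sum_(x in X) \sum_(y in Y) w x y * (f x - f y) ^+ 2 = W X Y * (p - q) ^+ 2.
  move=> fX fY; rewrite mulr_suml; apply: eq_bigr => x xX.
  by rewrite mulr_suml; apply: eq_bigr => y yY; rewrite fX ?fY.
have row (X : {set T}) p : (forall x, x \in X -> f x = p) ->
    \sum_(x in X) \sum_y w x y * (f x - f y) ^+ 2 =
      W X A * (p - a) ^+ 2 + W X B * (p - b) ^+ 2 + W X C * (p - c) ^+ 2.
  move=> fX; rewrite -(block _ _ _ _ fX fA) -(block _ _ _ _ fX fB).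
  rewrite -(block _ _ _ _ fX fC) -!big_split; apply: eq_bigr => x _.
  exact: sum_tripartition.
rewrite (sum_tripartition _ disjAB) -/C (row _ _ fA) (row _ _ fB) (row _ _ fC).
rewrite (W_sym B A) (W_sym C A) (W_sym C B) -!/(W _ _); ring.
Qed.

(** The Poincare inequality for the step function with values a, b, c. *)
Lemma tripartition_poincare (R : rcfType) (d : nat) (G : sgraph)
    (A B C : {set G}) (a b c : R) :
  regular d G -> eigval R G 2 < d%:R -> [disjoint A & B] -> C = ~: (A :|: B) ->
  (d%:R - eigval R G 2) *
      (#|A|%:R * #|B|%:R * (a - b) ^+ 2 + #|B|%:R * #|C|%:R * (b - c) ^+ 2
       + #|A|%:R * #|C|%:R * (a - c) ^+ 2)
    <= #|G|%:R * ((edges A B)%:R * (a - b) ^+ 2 + (edges B C)%:R * (b - c) ^+ 2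
       + (edges A C)%:R * (a - c) ^+ 2).
Proof.
move=> regG lambda2_lt disjAB defC.
pose f x := if x \in A then a else if x \in B then b else c.
have card_sum (X Y : {set G}) :
    \sum_(x in X) \sum_(y in Y) 1 = #|X|%:R * #|Y|%:R :> R.
  by rewrite !sumr_const mulr_natl.
have edges_sum (X Y : {set G}) :
    \sum_(x in X) \sum_(y in Y) (adj x y)%:R = (edges X Y)%:R :> R.
  by rewrite natr_sum; apply: eq_bigr => x _; rewrite natr_sum.
have := poincare_inequality regG lambda2_lt f.
have := double_sum_step (w := fun _ _ => 1) a b c disjAB (fun _ _ => erefl).
rewrite /= !card_sum -defC; under eq_bigr do under eq_bigr do rewrite mul1r.
move=> ->.
rewrite double_sum_step //; last by move=> x y; rewrite adj_sym.
rewrite !edges_sum -defC; lra.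
Qed.

(** * Sparse configurations excluded by the eigenvalue bound *)

(** The second largest eigenvalue of G_d. *)
Definition theta (R : rcfType) (d : nat) : R :=
  (Num.sqrt (1 + 4 * (d%:R - 1) ^+ 2) - 1) / 2.

Lemma theta_root (R : rcfType) (d : nat) :
  theta R d ^+ 2 + theta R d = (d%:R - 1) ^+ 2.
Proof.
have : Num.sqrt (1 + 4 * (d%:R - 1) ^+ 2) ^+ 2 = 1 + 4 * (d%:R - 1) ^+ 2 :> R.
  by rewrite sqr_sqrtr // addr_ge0 // mulr_ge0 // sqr_ge0.
by rewrite /theta; set s := Num.sqrt _ => s_sq; lra.
Qed.

Lemma theta_ge0 (R : rcfType) (d : nat) : 0 <= theta R d.
Proof.
rewrite /theta divr_ge0 // subr_ge0 -[X in X <= _]sqrtr1 ler_sqrt.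
  by rewrite lerDl mulr_ge0 // sqr_ge0.
by rewrite addr_ge0 // mulr_ge0 // sqr_ge0.
Qed.

Lemma theta_lt (R : rcfType) (d : nat) :
  (3 <= d)%N -> theta R d < d%:R - 4 / 3.
Proof.
move=> d_ge3; have d3 : 3 <= d%:R :> R by rewrite (ler_nat R 3).
have := theta_root R d; have := theta_ge0 R d.
move: (theta R d) => t t_ge0 t_eq.
by rewrite ltNge; apply/negP => t_gt; nra.
Qed.

Lemma theta_gt (R : rcfType) (d : nat) :
  (3 <= d)%N -> d%:R - 3 / 2 < theta R d.
Proof.
move=> d_ge3; have d3 : 3 <= d%:R :> R by rewrite (ler_nat R 3).
have := theta_root R d; have := theta_ge0 R d.
move: (theta R d) => t t_ge0 t_eq.
by rewrite ltNge; apply/negP => t_gt; nra.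
Qed.

(** Here L stands for d - theta, and n0, s, s - 1 for the sizes of three parts,
with e and d (s - 1) edges between consecutive ones.  For the step function
whose consecutive differences are u and v, with v minimizing the resulting
quadratic form for the given u, the two sides with e = d differ by u N H, where H is a
combination of n0 - d, s - d and their product with positive coefficients. *)
Lemma extremal_sizes (R : realFieldType) (d L n0 s e : R) :
  3 <= d -> 0 < L -> L <= 3 / 2 -> L ^+ 2 - (2 * d + 1) * L + (3 * d - 1) = 0 ->
  d <= n0 -> d <= s -> e <= d ->
  let N := n0 + s + (s - 1) in
  let v := L * n0 in let u := N * d - L * (s + n0) in
  L * (n0 * s * u ^+ 2 + s * (s - 1) * v ^+ 2 + n0 * (s - 1) * (u + v) ^+ 2)
    <= N * (e * u ^+ 2 + d * (s - 1) * v ^+ 2) ->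
  n0 = d /\ s = d.
Proof.
move=> d_ge3 L_gt0 L_le L_root n0_ge s_ge e_le N v u le_form.
have N_gt0 : 0 < N by rewrite /N; lra.
have u_gt0 : 0 < u by rewrite /u /N; nra.
pose p := n0 - d; pose q := s - d.
have p_ge0 : 0 <= p by rewrite /p; lra.
have q_ge0 : 0 <= q by rewrite /q; lra.
pose H := d * (d - 1) * q + d * (2 * d - 1 - L) * p + (3 * d - 1 - L) * (p * q).
have form_eq : L * (n0 * s * u ^+ 2 + s * (s - 1) * v ^+ 2
       + n0 * (s - 1) * (u + v) ^+ 2) - N * (d * u ^+ 2 + d * (s - 1) * v ^+ 2)
     = u * N * H.
  have L2 : L ^+ 2 = (2 * d + 1) * L - (3 * d - 1) by lra.
  (* With the equation for L undone, [form_eq] is a polynomial identity. *)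
  have H_eq : H = - n0 * s * L ^+ 2 + L * (d * n0 * (2 * s - 1) + d * (s + n0))
       - N * d ^+ 2.
    by rewrite L2 /H /N /p /q; ring.
  by rewrite H_eq /u /v /N; ring.
have H_le0 : H <= 0.
  have : u * N * H <= 0.
    rewrite -form_eq subr_le0 (le_trans le_form) // ler_pM2l // lerD2r.
    by rewrite ler_wpM2r // sqr_ge0.
  by rewrite pmulr_rle0 // mulr_gt0.
have pq_ge0 : 0 <= (3 * d - 1 - L) * (p * q).
  by rewrite !mulr_ge0 //; lra.
have cq : 0 < d * (d - 1) by rewrite mulr_gt0 //; lra.
have cp : 0 < d * (2 * d - 1 - L) by rewrite mulr_gt0 //; lra.
have p0 : p = 0.
  apply/eqP; rewrite eq_le p_ge0 andbT leNgt; apply/negP => p_gt0.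
  have := mulr_gt0 cp p_gt0; have := mulr_ge0 (ltW cq) q_ge0.
  by move: H_le0; rewrite /H; lra.
have q0 : q = 0.
  apply/eqP; rewrite eq_le q_ge0 andbT leNgt; apply/negP => q_gt0.
  have := mulr_gt0 cq q_gt0; have := mulr_ge0 (ltW cp) p_ge0.
  by move: H_le0; rewrite /H; lra.
by split; apply/eqP; rewrite -subr_eq0 -/p -/q ?p0 ?q0.
Qed.

Section SpectralObstructions.
Variables (R : rcfType) (d : nat) (G : sgraph).
Hypotheses (d_ge3 : (3 <= d)%N) (regG : regular d G).
Hypothesis lambda2_le : eigval R G 2 <= theta R d.

Let lambda2_lt : eigval R G 2 < d%:R.
Proof.
apply: le_lt_trans lambda2_le _; apply: lt_le_trans (theta_lt R d_ge3) _.
by lra.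
Qed.

Let gap43 : 4 / 3 < d%:R - eigval R G 2.
Proof.
by have := le_lt_trans lambda2_le (theta_lt R d_ge3); lra.
Qed.

(** Test function: |B| on A, - |A| on B and 0 elsewhere.  The constant 4/3 is a
lower bound for d - lambda2 that is uniform in d. *)
Lemma disjoint_sparse_sets (A B : {set G}) :
  [disjoint A & B] -> edges A B = 0%N -> A != set0 -> B != set0 ->
  (3 * edges A (~: (A :|: B)) <= 4 * #|A|)%N ->
  (3 * edges B (~: (A :|: B)) <= 4 * #|B|)%N -> False.
Proof.
move=> disjAB edgesAB; rewrite -!card_gt0.
set C := ~: (A :|: B) => A_gt0 B_gt0 sparseA sparseB.
have cardG : (#|G| = #|A| + #|B| + #|C|)%N.
  by rewrite -(cardsC (A :|: B)) cardsU disjoint_setI0 // cards0 subn0.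
have := tripartition_poincare #|B|%:R (- #|A|%:R) 0
  regG lambda2_lt disjAB (erefl _).
rewrite edgesAB -/C cardG mul0r add0r !natrD.
move: sparseA sparseB A_gt0 B_gt0; rewrite -!(ler_nat R) !natrM.
move: (ler0n R #|C|) gap43.
move: (#|A|%:R) (#|B|%:R) (#|C|%:R) (edges A C)%:R (edges B C)%:R.
move: (d%:R - eigval R G 2) => l a b c ea eb c_ge0 l_gt sA sB a_ge1 b_ge1.
have P_gt0 : 0 < a * b * (a + b) * (a + b + c).
  by rewrite !mulr_gt0 //; lra.
have eab : ea * b ^+ 2 + eb * a ^+ 2 <= 4 / 3 * (a * b * (a + b)).
  have : 0 <= (4 * a - 3 * ea) * b ^+ 2 by rewrite mulr_ge0 ?sqr_ge0 //; lra.
  have : 0 <= (4 * b - 3 * eb) * a ^+ 2 by rewrite mulr_ge0 ?sqr_ge0 //; lra.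
  lra.
apply/negP; rewrite -ltNge.
apply: (@le_lt_trans _ _ (4 / 3 * (a * b * (a + b) * (a + b + c)))).
  have : 0 <= (4 / 3 * (a * b * (a + b)) - (ea * b ^+ 2 + eb * a ^+ 2))
              * (a + b + c).
    by rewrite mulr_ge0 //; lra.
  lra.
apply: (@lt_le_trans _ _ (l * (a * b * (a + b) * (a + b + c)))).
  by rewrite ltr_pM2r.
by rewrite le_eqVlt; apply/orP; left; apply/eqP; ring.
Qed.

(** Test function: the indicator of A. *)
Lemma sparse_cut (A : {set G}) :
  A != set0 -> ~: A != set0 ->
  (3 * (edges A (~: A) * #|G|) <= 4 * (#|A| * #|~: A|))%N -> False.
Proof.
rewrite -!card_gt0 => A_gt0 B_gt0; set B := ~: A in B_gt0 *.
have disjAB : [disjoint A & B] by rewrite disjoints_subset /B setCK.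
have C0 : ~: (A :|: B) = set0 by rewrite /B setUCr setCT.
have cardG : (#|A| + #|B| = #|G|)%N by rewrite cardsC.
have := tripartition_poincare 1 0 0 regG lambda2_lt disjAB (erefl _).
have edges0 : edges A set0 = 0%N by apply: big1 => x _; rewrite big_set0.
rewrite C0 cards0 edges0 -cardG => le_form sparse.
move: le_form sparse A_gt0 B_gt0.
rewrite -!(ler_nat R) !natrM !natrD.
move: gap43 (ler0n R (edges A B)).
move: (#|A|%:R) (#|B|%:R) (edges A B)%:R => a b e.
move: (d%:R - eigval R G 2) => l l_gt e_ge0.
rewrite !subr0 expr0n /= !mulr0 !addr0 expr1n !mulr1 => le_form sparse a1 b1.
have : 0 < (l - 4 / 3) * (a * b) by rewrite !mulr_gt0 //; lra.
lra.
Qed.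

(** In G_d itself the parts are K_d, the side of size d of K_{d, d-1}, and the
side of size d - 1; there the inequality used here is an equality. *)
Lemma extremal_tripartition (A B C : {set G}) :
  [disjoint A & B] -> C = ~: (A :|: B) ->
  edges A C = 0%N -> (edges A B <= d)%N ->
  (#|C|.+1 = #|B|)%N -> edges B C = (d * #|C|)%N ->
  (d <= #|A|)%N -> (d <= #|B|)%N -> #|A| = d /\ #|B| = d.
Proof.
move=> disjAB defC edgesAC edgesAB cardB edgesBC A_ge B_ge.
have cardG : (#|G| = #|A| + #|B| + #|C|)%N.
  by rewrite -(cardsC (A :|: B)) cardsU disjoint_setI0 // cards0 subn0 -defC.
set n0 : R := #|A|%:R; set s : R := #|B|%:R.
pose L : R := d%:R - theta R d.
pose N := n0 + s + (s - 1).
pose v := L * n0; pose u := N * d%:R - L * (s + n0).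
have := tripartition_poincare u 0 (- v) regG lambda2_lt disjAB defC.
rewrite edgesAC edgesBC subr0 sub0r opprK mul0r addr0.
have cardC : #|C|%:R = s - 1 by rewrite /s -cardB -natr1 addrK.
have -> : #|G|%:R = N by rewrite cardG !natrD cardC.
rewrite natrM cardC -/n0 -/s => le_form.
have [d_ge n0_ge s_ge e_le] :
    [/\ 3 <= d%:R :> R, d%:R <= n0, d%:R <= s & (edges A B)%:R <= d%:R :> R].
  by split; rewrite ?/n0 ?/s ?(ler_nat R 3) ?ler_nat.
have [] : n0 = d%:R /\ s = d%:R; last first.
  by move=> /eqP + /eqP; rewrite !eqr_nat => /eqP + /eqP.
have := theta_root R d; have := theta_gt R d_ge3; have := theta_lt R d_ge3.
move=> lt_theta gt_theta root_theta.
have L_gt : 4 / 3 < L by rewrite /L; lra.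
apply: (@extremal_sizes _ _ L _ _ (edges A B)%:R) => //.
- by lra.
- by rewrite /L; lra.
- by rewrite /L; lra.
set Y := (X in L * X <= _).
have Y_ge0 : 0 <= Y.
  by rewrite !addr_ge0 // mulr_ge0 ?sqr_ge0 // mulr_ge0 //; lra.
have le_gap : L <= d%:R - eigval R G 2 by rewrite /L lerD2l lerN2.
apply: le_trans (ler_wpM2r Y_ge0 le_gap) _.
exact: le_form.
Qed.

End SpectralObstructions.

(** * Edge counts *)

Section EdgeCounts.
Local Open Scope nat_scope.
Variable G : sgraph.
Implicit Types A B X Y : {set G}.

Lemma edges_eq0P A B :
  reflect (forall x y, x \in A -> y \in B -> ~~ adj x y) (edges A B == 0).
Proof.
rewrite /edges sum_nat_eq0; apply: (iffP forallP) => [noAB x y xA yB | noAB x].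
  have /implyP/(_ xA) := noAB x; rewrite sum_nat_eq0 => /forallP/(_ y).
  by rewrite yB eqb0.
apply/implyP => xA; rewrite sum_nat_eq0; apply/forallP => y.
by apply/implyP => yB; rewrite eqb0 noAB.
Qed.

Lemma edges_eq_nbrs A X Y :
  (forall x y, x \in A -> adj x y -> (y \in X) = (y \in Y)) ->
  edges A X = edges A Y.
Proof.
move=> nbrXY; apply: eq_bigr => x xA.
rewrite big_mkcond [RHS]big_mkcond; apply: eq_bigr => y _ /=.
have [/(nbrXY x y xA) -> // | _] := boolP (adj x y).
by do 2 case: ifP.
Qed.

Lemma edges_add_compl A X : edges A X + edges A (~: X) = edges A [set: G].
Proof.
rewrite -big_split; apply: eq_bigr => x _ /=.
rewrite [RHS](bigID [in X]) /=; congr (_ + _); apply: eq_bigl => y.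
  by rewrite inE.
by rewrite !inE.
Qed.

Lemma edges_regular d A : regular d G -> edges A [set: G] = d * #|A|.
Proof.
move=> regG; rewrite mulnC -sum_nat_const; apply: eq_bigr => x _.
rewrite -(regG x) -sum1_card [RHS]big_mkcond [LHS]big_mkcond /=.
by apply: eq_bigr => y _; rewrite !inE; case: adj.
Qed.

(** A vertex is not its own neighbour, so each row of A contributes at most
|A| - 1. *)
Lemma edges_self_le A : edges A A + #|A| <= #|A| * #|A|.
Proof.
rewrite -sum_nat_const -[X in _ + X]sum1_card -big_split /=.
apply: leq_sum => x xA; rewrite addn1 (bigD1 x) //= adj_irrefl add0n.
rewrite [ltnRHS](cardD1 x) xA -sum1_card ltnS.
rewrite [leqRHS](eq_bigl (fun y => (y \in A) && (y != x))) /=; last first.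
  by move=> y; rewrite !inE andbC.
by apply: leq_sum => y _; case: adj.
Qed.

(** Otherwise A would be closed under adjacency, hence a union of components. *)
Lemma connected_cut A :
  connected G -> A != set0 -> ~: A != set0 -> 0 < edges A (~: A).
Proof.
move=> connG /set0Pn[x xA] /set0Pn[y yA].
rewrite lt0n; apply/negP => /edges_eq0P noAB.
have closedA : closed (@adj G) (mem A).
  apply: intro_closed; first exact: (sym_connect_sym (@adj_sym G)).
  move=> a b ab aA; apply/negPn/negP => bA.
  by have := noAB a b aA; rewrite inE bA ab => /(_ isT).
suff /(closed_connect closedA) : connect (@adj G) x y.
  by rewrite /= xA; move: yA; rewrite inE => /negPf->.
have sym_c := sym_connect_sym (@adj_sym G).
rewrite -(root_connect sym_c).
have : num_comp G <= 1 by rewrite connG.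
rewrite /num_comp /n_comp_mem => /card_le1_eqP one_root.
by apply/eqP/one_root; rewrite !inE (roots_root sym_c).
Qed.

End EdgeCounts.

(** * Recognizing G_d *)

Section Recognition.
Local Open Scope nat_scope.

Definition nbrs_in (G : sgraph) (x : G) (X : {set G}) := [set y in X | adj x y].

Lemma edges_sum_nbrs (G : sgraph) (X Y : {set G}) :
  edges X Y = \sum_(x in X) #|nbrs_in x Y|.
Proof.
apply: eq_bigr => x _; rewrite -sum1_card big_mkcond [RHS]big_mkcond /=.
by apply: eq_bigr => y _; rewrite inE; case: (y \in Y) => //; case: adj.
Qed.

Lemma sum_eq_min (T : finType) (A : {set T}) (f : T -> nat) (m : nat) :
  (forall x, x \in A -> m <= f x) -> \sum_(x in A) f x <= m * #|A| ->
  forall x, x \in A -> f x = m.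
Proof.
move=> f_ge sum_le x xA; apply/eqP; rewrite eqn_leq f_ge // andbT leqNgt.
apply/negP => f_gt; move: sum_le; apply/negP; rewrite -ltnNge.
rewrite mulnC -sum_nat_const (bigD1 x) //= [ltnRHS](bigD1 x) //=.
rewrite -addSn leq_add // leq_sum // => y /andP[yA _]; exact: f_ge.
Qed.

Definition rank_in (T : finType) (n : nat) (A : {set T}) (x : T) : 'I_n.+1 :=
  inord (index x (enum A)).

Lemma rank_in_inj (T : finType) (n : nat) (A : {set T}) :
  #|A| <= n.+1 -> {in A &, injective (rank_in n A)}.
Proof.
move=> cardA x y xA yA /(congr1 val); rewrite /= !inordK.
- have xE : x \in enum A by rewrite mem_enum.
  by move=> eq_idx; rewrite -(nth_index x xE) eq_idx nth_index ?mem_enum.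
- by rewrite (leq_trans _ cardA) // cardE index_mem mem_enum.
- by rewrite (leq_trans _ cardA) // cardE index_mem mem_enum.
Qed.

Variables (d : nat) (G : sgraph) (A B C : {set G}).
Hypotheses (d_gt1 : 1 < d) (regG : regular d G).
Hypotheses (disjAB : [disjoint A & B]) (defC : C = ~: (A :|: B)).
Hypotheses (cardA : #|A| = d) (cardB : #|B| = d) (cardC : #|C| = d.-1).
Hypotheses (noAC : edges A C = 0) (noBB : edges B B = 0) (noCC : edges C C = 0).

Let nadjAC x y : x \in A -> y \in C -> ~~ adj x y.
Proof. by move=> *; apply: (edges_eq0P _ _ (introT eqP noAC)). Qed.

Let nadjBB x y : x \in B -> y \in B -> ~~ adj x y.
Proof. by move=> *; apply: (edges_eq0P _ _ (introT eqP noBB)). Qed.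

Let nadjCC x y : x \in C -> y \in C -> ~~ adj x y.
Proof. by move=> *; apply: (edges_eq0P _ _ (introT eqP noCC)). Qed.

Let tripart x : [\/ [/\ x \in A, x \notin B & x \notin C],
                    [/\ x \notin A, x \in B & x \notin C]
                  | [/\ x \notin A, x \notin B & x \in C]].
Proof.
rewrite defC !inE; have := disjointFr disjAB (x := x).
case: (x \in A) => [/(_ isT) -> |_]; first by constructor 1.
by case: (x \in B); [constructor 2 | constructor 3].
Qed.

Lemma card_nbrs_tripartition x :
  #|nbrs_in x A| + #|nbrs_in x B| + #|nbrs_in x C| = d.
Proof.
have card_sum (X : {set G}) : #|X| = \sum_y (y \in X).
  by rewrite -sum1_card big_mkcond; apply: eq_bigr => y _; case: (y \in X).
rewrite -(regG x) !card_sum -!big_split /=.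
apply: eq_bigr => y _; rewrite !inE.
by case: (tripart y) => -[] =>
  [-> /negPf-> /negPf->|/negPf-> -> /negPf->|/negPf-> /negPf-> ->]; case: adj.
Qed.

Let nbrs0 x (X : {set G}) :
  (forall y, y \in X -> ~~ adj x y) -> #|nbrs_in x X| = 0.
Proof.
move=> nadj; apply/eqP; rewrite cards_eq0; apply/eqP/setP => y.
by rewrite !inE; apply/andP => -[/nadj/negPf->].
Qed.

Lemma adj_all_of_card x (X : {set G}) : #|X| <= #|nbrs_in x X| ->
  forall y, y \in X -> adj x y.
Proof.
move=> card_le y yX; have : nbrs_in x X = X.
  apply/eqP; rewrite eqEcard card_le andbT.
  by apply/subsetP => z; rewrite inE => /andP[].
by move/setP/(_ y); rewrite inE yX.
Qed.

(** A vertex of C has all of its d neighbours in B, which has d elements. *)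
Lemma adjCB x y : x \in C -> y \in B -> adj x y.
Proof.
move=> xC; apply: adj_all_of_card; have := card_nbrs_tripartition x.
rewrite (nbrs0 (X := A)); last by move=> z zA; rewrite adj_sym nadjAC.
rewrite (nbrs0 (X := C)); last by move=> z zC; rewrite nadjCC.
by rewrite cardB add0n addn0 => ->.
Qed.

(** A vertex of B spends d - 1 of its edges on C. *)
Lemma card_nbrs_BA x : x \in B -> #|nbrs_in x A| = 1.
Proof.
move=> xB; have := card_nbrs_tripartition x.
rewrite (nbrs0 (X := B)); last by move=> z zB; rewrite nadjBB.
have -> : nbrs_in x C = C.
  by apply/setP => z; rewrite inE; case zC: (z \in C); rewrite // adj_sym adjCB.
by rewrite cardC; lia.
Qed.

Lemma nbrs_in_self_lt x : x \in A -> #|nbrs_in x A| < #|A|.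
Proof.
move=> xA; apply: proper_card; apply/properP; split.
  by apply/subsetP => z; rewrite inE => /andP[].
by exists x => //; rewrite inE adj_irrefl andbF.
Qed.

(** Each vertex of A has at most d - 1 neighbours in A, so at least one in B;
and B sends only d edges to A in all. *)
Lemma card_nbrs_AB x : x \in A -> #|nbrs_in x B| = 1.
Proof.
move: x; apply: sum_eq_min => [x xA|].
  have := card_nbrs_tripartition x; have := nbrs_in_self_lt xA.
  by rewrite (nbrs0 (X := C)) ?cardA => [|y yC]; [lia | rewrite nadjAC].
rewrite -edges_sum_nbrs edgesC edges_sum_nbrs (eq_bigr (fun=> 1)).
  by rewrite sum1_card cardA cardB mul1n.
by move=> x xB; rewrite card_nbrs_BA.
Qed.

Lemma adjAA x y : x \in A -> y \in A -> adj x y = (x != y).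
Proof.
move=> xA yA; have [<-|neq_xy] := eqVneq x y; first by rewrite adj_irrefl.
have sub : nbrs_in x A \subset A :\ x.
  apply/subsetP => z; rewrite !inE => /andP[-> xz]; rewrite andbT.
  by apply/eqP => zx; rewrite zx adj_irrefl in xz.
have : nbrs_in x A = A :\ x.
  apply/eqP; rewrite eqEcard sub.
  have := card_nbrs_tripartition x; rewrite card_nbrs_AB //.
  rewrite (nbrs0 (X := C)) => [|z zC]; last by rewrite nadjAC.
  by have := cardsD1 x A; rewrite xA cardA; lia.
by move/setP/(_ y); rewrite !inE yA eq_sym neq_xy.
Qed.

(** The matching between A and B.  The default x is never reached for x in A. *)
Definition mate x : G := odflt x [pick y in nbrs_in x B].

Lemma mateP x y : x \in A -> y \in B -> adj x y = (mate x == y).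
Proof.
move=> xA yB; have /eqP/cards1P[z nbrE] := card_nbrs_AB xA.
have -> : mate x = z.
  rewrite /mate; case: pickP => [w|/(_ z)]; rewrite nbrE !inE ?eqxx //.
  by move/eqP.
by have /setP/(_ y) := nbrE; rewrite !inE yB eq_sym.
Qed.

Lemma mate_in x : x \in A -> mate x \in B.
Proof.
move=> xA; rewrite /mate; case: pickP => [w|none].
  by rewrite inE => /andP[].
by have := card_nbrs_AB xA; rewrite eq_card0.
Qed.

Lemma mate_inj : {in A &, injective mate}.
Proof.
move=> x y xA yA eq_mate; have xB := mate_in xA.
have /eqP/cards1P[z nbrE] := card_nbrs_BA xB.
have memz w : w \in A -> mate w = mate x -> w = z.
  move=> wA eq_w; apply/set1P; rewrite -nbrE inE wA adj_sym mateP //.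
  exact/eqP.
by rewrite (memz x) // (memz y).
Qed.

(** A vertex of B is numbered by its rank and a vertex of A by the rank of its
mate, so that the perfect matching becomes equality of indices. *)
Lemma isomorphic_Gd : isomorphic G (Gd d).
Proof.
case: d d_gt1 cardA cardB cardC => [|[|n]] // _ cA cB cC.
pose f (x : G) : Gd n.+2 :=
  if x \in B then inl (inl (rank_in n.+1 B x))
  else if x \in C then inl (inr (rank_in n C x))
  else inr (rank_in n.+1 B (mate x)).
have rkB := @rank_in_inj _ n.+1 B; rewrite cB leqnn in rkB.
have rkC := @rank_in_inj _ n C; rewrite cC leqnn in rkC.
have {}rkB := rkB isT; have {}rkC := rkC isT.
have inA x : x \in A -> f x = inr (rank_in n.+1 B (mate x)).
  rewrite /f => xA; case: (tripart x) => -[]; rewrite ?xA //.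
  by move=> _ /negPf-> /negPf->.
have inB x : x \in B -> f x = inl (inl (rank_in n.+1 B x)) by rewrite /f => ->.
have inC x : x \in C -> f x = inl (inr (rank_in n C x)).
  rewrite /f => xC; case: (tripart x) => -[]; rewrite ?xC //.
  by move=> _ /negPf->.
have inj_f : injective f.
  move=> x y; case: (tripart x) => -[xA xB xC];
    [rewrite (inA x xA) | rewrite (inB x xB) | rewrite (inC x xC)];
    case: (tripart y) => -[yA yB yC];
    [rewrite (inA y yA) | rewrite (inB y yB) | rewrite (inC y yC) |
     rewrite (inA y yA) | rewrite (inB y yB) | rewrite (inC y yC) |
     rewrite (inA y yA) | rewrite (inB y yB) | rewrite (inC y yC)] => //.
  - by case=> eq_rk; apply: mate_inj => //; apply: rkB => //; exact: mate_in.
  - by case=> eq_rk; exact: rkB.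
  - by case=> eq_rk; exact: rkC.
exists f.
  apply: inj_card_bij => //; rewrite -(cardsC (A :|: B)) -defC cardsU.
  rewrite disjoint_setI0 // cards0 subn0 cA cB cC.
  by rewrite !card_sum !card_ord /=; lia.
have eq_rank (T : finType) m (X : {set T}) x y :
  {in X &, injective (rank_in m X)} -> x \in X -> y \in X ->
  (rank_in m X x == rank_in m X y) = (x == y).
  by move=> inj xX yX; apply/eqP/eqP => [eq_rk|-> //]; exact: inj.
move=> x y; case: (tripart x) => -[xA xB xC];
    [rewrite (inA x xA) | rewrite (inB x xB) | rewrite (inC x xC)];
    case: (tripart y) => -[yA yB yC];
    [rewrite (inA y yA) | rewrite (inB y yB) | rewrite (inC y yC) |
     rewrite (inA y yA) | rewrite (inB y yB) | rewrite (inC y yC) |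
     rewrite (inA y yA) | rewrite (inB y yB) | rewrite (inC y yC)] => /=.
- by rewrite eq_rank ?mate_in // adjAA // (inj_in_eq mate_inj).
- by rewrite eq_rank ?mate_in // eq_sym mateP // eq_sym.
- by rewrite (negPf (nadjAC _ _)).
- by rewrite eq_rank ?mate_in // adj_sym mateP // eq_sym.
- by rewrite (negPf (nadjBB _ _)).
- by rewrite adj_sym adjCB.
- by rewrite adj_sym (negPf (nadjAC _ _)).
- by rewrite adjCB.
- by rewrite (negPf (nadjCC _ _)).
Qed.

End Recognition.

(** * Vertex cuts with many components *)

Section Blocks.
Local Open Scope nat_scope.
Variables (d : nat) (G : sgraph) (I : finType) (label : G -> option I).
Hypotheses (regG : regular d G).

(** For the labelling by components of G - S, with [None] on S, the blocks are
the components and the cutset is S. *)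
Definition cutset := [set x | label x == None].
Definition block i := [set x | label x == Some i].

Hypothesis block_neq0 : forall i, block i != set0.
Hypothesis adj_block : forall x y i j,
  adj x y -> label x = Some i -> label y = Some j -> i = j.

Local Notation S := cutset.
Local Notation B := block.
Local Notation e i := (edges (block i) cutset).

Lemma nbr_block x y i : x \in B i -> adj x y -> (y \in S) = (y \notin B i).
Proof.
rewrite !inE => /eqP lab_x xy; case lab_y : (label y) => [j|] //=.
by rewrite (adj_block xy lab_x lab_y) eqxx.
Qed.

Lemma edges_block_compl i : edges (B i) (~: B i) = e i.
Proof. by apply: edges_eq_nbrs => x y xB xy; rewrite inE (nbr_block xB xy). Qed.

Lemma edges_block_setU i j : edges (B i) (~: (B i :|: B j)) = e i.
Proof.
apply: edges_eq_nbrs => x y xB xy; rewrite (nbr_block xB xy) !inE.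
case: eqP => //= lab_i; case: eqP => // lab_y.
move: xB; rewrite inE => /eqP lab_x.
by have := adj_block xy lab_x lab_y => ij; rewrite ij lab_y in lab_i.
Qed.

Lemma disjoint_blocks i j : i != j -> [disjoint B i & B j].
Proof.
move=> neq_ij; rewrite disjoints_subset; apply/subsetP => x.
by rewrite !inE => /eqP->; rewrite (inj_eq (@Some_inj _)).
Qed.

Lemma edges_blocks i j : i != j -> edges (B i) (B j) = 0.
Proof.
move=> neq_ij; apply/eqP/edges_eq0P => x y; rewrite !inE => /eqP lx /eqP ly.
by apply/negP => /adj_block/(_ lx ly)/eqP; rewrite (negPf neq_ij).
Qed.

(** Each vertex of the block has d neighbours, at most |B i| - 1 of them inside
the block and all others in the cutset.  The right-hand side carries |B i| ^ 2 to
avoid truncated subtraction. *)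
Lemma block_size_bound i : #|B i| * d.+1 <= e i + #|B i| * #|B i|.
Proof.
have := edges_self_le (B i); have := edges_add_compl (B i) (B i).
by rewrite edges_block_compl (edges_regular _ regG); lia.
Qed.

Lemma sum_blocks (f : G -> nat) :
  \sum_(x in ~: S) f x = \sum_i \sum_(x in B i) f x.
Proof.
under [RHS]eq_bigr do rewrite big_mkcond.
rewrite exchange_big big_mkcond; apply: eq_bigr => x _ /=.
rewrite !inE; case lab_x: (label x) => [i|] /=; last first.
  by rewrite big1 // => i _; rewrite inE lab_x.
rewrite (bigD1 i) //= inE lab_x eqxx big1 ?addn0 // => j.
by rewrite inE lab_x (inj_eq (@Some_inj _)) eq_sym => /negPf->.
Qed.

Lemma sum_edges_blocks : \sum_i e i + edges S S = d * #|S|.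
Proof.
rewrite -(edges_regular _ regG) -(edges_add_compl S S) addnC.
by congr (_ + _); rewrite [RHS]edgesC; symmetry; exact: sum_blocks.
Qed.

Lemma block_edges_gt0 i : connected G -> 1 < #|I| -> 0 < e i.
Proof.
move=> connG /card_gt1P[j [k [_ _ neq_jk]]]; rewrite -edges_block_compl.
apply: connected_cut => //.
suff [l neq_li] : exists l, l != i.
  have /set0Pn[x xB] := block_neq0 l; apply/set0Pn; exists x.
  move: xB; rewrite !inE => /eqP->.
  by rewrite (inj_eq (@Some_inj _)).
have [eq_ij|neq_ij] := eqVneq j i; last by exists j.
by exists k; rewrite eq_sym -eq_ij.
Qed.

Lemma block_small_boundary i : e i < d -> d < #|B i|.
Proof.
have := block_size_bound i; have := block_neq0 i; rewrite -card_gt0.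
move: #|B i| (e i) => n m n_gt0 bound m_lt; rewrite ltnNge; apply/negP => n_le.
by nia.
Qed.

(** Because the product n (d + 1 - n) exceeds d for 1 < n < d. *)
Lemma block_medium_boundary i : e i <= d -> 1 < #|B i| -> d <= #|B i|.
Proof.
have := block_size_bound i; move: #|B i| (e i) => n m bound m_lt n_gt1.
by rewrite leqNgt; apply/negP => n_le; nia.
Qed.

(** Without such a block every block sends at least d edges to the cutset, so
the degree sum of the cutset leaves no slack: the cutset is independent, the blocks
are single vertices, and the cutset is one side of a bipartition. *)
Lemma exists_sparse_block :
  ~ bipartite G -> #|S| <= #|I| -> exists2 i, e i <= d & d <= #|B i|.
Proof.
move=> nbipG S_le.
have [i /andP[e_le B_ge]|none] := pickP (fun i => (e i <= d) && (d <= #|B i|)).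
  by exists i.
have e_ge i : d <= e i.
  rewrite leqNgt; apply/negP => e_lt; have := block_small_boundary e_lt.
  by have := none i; rewrite (ltnW e_lt) /=; lia.
have sum_ge : d * #|I| <= \sum_i e i.
  by rewrite mulnC -sum_nat_const; apply: leq_sum.
have sum_eq := sum_edges_blocks.
have S_eq0 : edges S S = 0 by nia.
have e_eq i : e i = d.
  apply: (sum_eq_min (A := [set: I]) (f := fun k => e k)) => //.
  rewrite cardsT (eq_bigl predT) => [|j]; last by rewrite inE.
  apply: (@leq_trans (d * #|S|)); last by rewrite leq_mul2l S_le orbT.
  by rewrite -sum_eq leq_addr.
case: nbipG; exists S => x y xy.
case lab_x : (label x) => [i|]; case lab_y : (label y) => [j|].
- have ij := adj_block xy lab_x lab_y.
  have B1 : #|B i| = 1.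
    apply/eqP; rewrite eqn_leq card_gt0 block_neq0 andbT leqNgt.
    apply/negP => B_gt1; have := none i.
    by rewrite block_medium_boundary ?e_eq ?leqnn.
  have /eqP/cards1P[z Bz] := B1.
  have : x \in B i by rewrite inE lab_x.
  have : y \in B i by rewrite inE lab_y ij.
  by rewrite Bz !inE => /eqP yz /eqP xz; rewrite yz xz adj_irrefl in xy.
- by rewrite !inE lab_x lab_y.
- by rewrite !inE lab_x lab_y.
have /eqP/edges_eq0P/(_ x y) := S_eq0.
by rewrite !inE lab_x lab_y xy => /(_ isT isT).
Qed.

Hypothesis d_ge3 : 3 <= d.
Variables (R : rcfType).
Hypothesis lambda2_le : (eigval R G 2 <= theta R d)%R.

(** Two blocks with at most 4/3 boundary edges per vertex cannot coexist. *)
Lemma dense_block i j : i != j -> e i <= d -> d <= #|B i| ->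
  4 * #|B j| < 3 * e j.
Proof.
move=> neq_ij e_le B_ge; rewrite ltnNge; apply/negP => sparse.
apply: (disjoint_sparse_sets d_ge3 regG lambda2_le (disjoint_blocks neq_ij)).
- exact: edges_blocks.
- exact: block_neq0.
- exact: block_neq0.
- by rewrite edges_block_setU; lia.
- by rewrite setUC edges_block_setU.
Qed.

Section SparseBlock.
Variable i0 : I.
Hypotheses (e0_le : e i0 <= d) (B0_ge : d <= #|B i0|).

Lemma other_boundary_ge j : j != i0 -> d <= e j.
Proof.
move=> neq_j; rewrite leqNgt; apply/negP => e_lt.
have := block_small_boundary e_lt.
have := dense_block (j := j) _ e0_le B0_ge.
by rewrite eq_sym neq_j => /(_ isT); lia.
Qed.

Hypothesis S_le : #|S| <= #|I|.

(** A larger block j sends more than d edges to the cutset, so by the degree sum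
block i0 sends fewer, is larger than d, and has at most 2 (d + 1) / 3 boundary
edges, while both sides of the cut around it have at least d + 1 vertices. *)
Lemma other_block_singleton j : j != i0 -> #|B j| = 1.
Proof.
move=> neq_j; apply/eqP; rewrite eqn_leq card_gt0 block_neq0 andbT leqNgt.
apply/negP => Bj_gt1.
have dense_j : 4 * #|B j| < 3 * e j.
  by apply: dense_block e0_le B0_ge; rewrite eq_sym.
have ej_gt : d < e j.
  by rewrite ltnNge; apply/negP => ej_le;
    have := block_medium_boundary ej_le Bj_gt1; lia.
have e0_ej : e i0 + e j <= 2 * d.
  have := sum_edges_blocks; rewrite (bigD1 i0) //= (bigD1 j) //=.
  have : d * #|~: [set i0; j]| <= \sum_(k | (k != i0) && (k != j)) e k.
    rewrite mulnC -sum_nat_const.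
    rewrite [leqRHS](eq_bigl [in ~: [set i0; j]]) => [|k]; last first.
      by rewrite !inE negb_or.
    by apply: leq_sum => k; rewrite !inE negb_or => /andP[/other_boundary_ge].
  have := cardsC [set i0; j]; rewrite cards2 eq_sym neq_j.
  by nia.
have B0_gt : d < #|B i0| by apply: block_small_boundary; lia.
(* The closed neighbourhood of any vertex of block j lies outside block i0. *)
have cmpl_gt : d < #|~: B i0|.
  have /set0Pn[x xB] := block_neq0 j.
  have -> : d.+1 = #|x |: [set y | adj x y]|.
    by rewrite cardsU1 regG inE adj_irrefl.
  apply/subset_leq_card/subsetP => y; rewrite !inE.
  move: xB; rewrite inE => /eqP lab_x.
  case/orP => [/eqP->|xy]; first by rewrite lab_x (inj_eq (@Some_inj _)).
  apply/eqP => lab_y; have := adj_block xy lab_x lab_y.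
  by apply/eqP.
have e0_bound : 3 * e i0 <= 2 * d.+1.
  have := block_size_bound j.
  (* If |B j| >= d, density gives e j > 4 d / 3; otherwise the size bound gives
     e j >= 2 (d - 1), so that e i0 <= 2. *)
  have [Bj_ge|Bj_lt] := leqP d #|B j|; first by lia.
  move: #|B j| (e j) (e i0) Bj_gt1 Bj_lt e0_ej dense_j.
  move=> n m k n_gt1 n_lt sum_le dense bound.
  have : 2 * d.-1 <= m by nia.
  lia.
apply: (sparse_cut d_ge3 regG lambda2_le (block_neq0 i0)).
  by rewrite -card_gt0; lia.
rewrite edges_block_compl -(cardsC (B i0)).
move: #|B i0| #|~: B i0| (e i0) B0_gt cmpl_gt e0_bound => n m k n_gt m_gt k_le.
have H1 : 3 * (k * n) <= 2 * (m * n).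
  by rewrite !mulnA leq_mul2r; apply/orP; right; lia.
have H2 : 3 * (k * m) <= 2 * (m * n).
  by rewrite [m * n]mulnC !mulnA leq_mul2r; apply/orP; right; lia.
by lia.
Qed.

Hypotheses (connG : connected G) (I_gt1 : 1 < #|I|).

Lemma sparse_block_isomorphic : isomorphic G (Gd d).
Proof.
pose C := ~: (B i0 :|: S).
have disjBS : [disjoint B i0 & S].
  rewrite disjoints_subset; apply/subsetP => x.
  by rewrite !inE => /eqP->.
have single := other_block_singleton.
have e_eq j : j != i0 -> e j = d.
  move=> neq_j; apply/eqP; rewrite eqn_leq other_boundary_ge // andbT.
  have := edges_add_compl (B j) S.
  by rewrite (edges_regular _ regG) single //; lia.
have nadjC x y : x \in C -> y \in ~: S -> ~~ adj x y.
  rewrite !inE negb_or; case lab_x : (label x) => [j|]; last by rewrite andbF.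
  case lab_y : (label y) => [k|] //=.
  rewrite (inj_eq (@Some_inj _)) andbT => neq_j _.
  apply/negP => xy; have jk := adj_block xy lab_x lab_y.
  have /eqP/cards1P[z Bz] := single _ neq_j.
  have : x \in B j by rewrite inE lab_x.
  have : y \in B j by rewrite inE lab_y jk.
  by rewrite Bz !inE => /eqP yz /eqP xz; rewrite yz xz adj_irrefl in xy.
have sub_C x : x \in C -> x \in ~: S by rewrite !inE negb_or => /andP[].
have noCC : edges C C = 0.
  by apply/eqP/edges_eq0P => x y xC /sub_C; exact: nadjC.
have no0C : edges (B i0) C = 0.
  rewrite edgesC; apply/eqP/edges_eq0P => x y xC; rewrite inE => /eqP lab_y.
  by apply: nadjC xC _; rewrite !inE lab_y.
have edgesSC : edges S C = d * #|C|.
  rewrite edgesC -(edges_regular _ regG); apply: edges_eq_nbrs => x y xC xy.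
  rewrite [RHS]inE; apply/negPn/negP => yS; have := nadjC x y xC.
  by rewrite in_setC yS xy => /(_ isT).
have others (f : I -> nat) m : (forall j, j != i0 -> f j = m) ->
    \sum_j f j = f i0 + m * #|I|.-1.
  move=> f_eq; rewrite (bigD1 i0) //= (eq_bigr (fun=> m)) //.
  by rewrite sum_nat_const mulnC -(cardC1 i0).
have := sum_edges_blocks; rewrite (others _ d) // => degree_sum.
have e0_gt0 := block_edges_gt0 i0 connG I_gt1.
have cardS : #|S| = #|I| by nia.
have cardG : #|B i0| + #|S| + #|C| = #|G|.
  by rewrite -(cardsC (B i0 :|: S)) cardsU disjoint_setI0 // cards0 subn0.
have cardC : #|C|.+1 = #|S|.
  have := sum_blocks (fun=> 1); rewrite sum1_card.
  under eq_bigr do rewrite sum1_card.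
  rewrite (others _ 1) //; have := cardsC S; lia.
have S_ge : d <= #|S|.
  have [j neq_j] : exists j, j != i0.
    have /card_gt1P[j [k [_ _ neq_jk]]] := I_gt1.
    have [eq_j|neq_j] := eqVneq j i0; last by exists j.
    by exists k; rewrite eq_sym -eq_j.
  rewrite -(e_eq j neq_j) -[leqRHS]mul1n -(single j neq_j) -!sum_nat_const.
  apply: leq_sum => x _; rewrite -sum1_card; apply: leq_sum => y _.
  by case: adj.
have [] := extremal_tripartition d_ge3 regG lambda2_le disjBS (erefl C).
- exact: no0C.
- exact: e0_le.
- exact: cardC.
- exact: edgesSC.
- exact: B0_ge.
- exact: S_ge.
move=> B0_eq S_eq; apply: (@isomorphic_Gd d G (B i0) S C) => //.
- by lia.
- by lia.
- by have := block_size_bound i0; nia.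
Qed.

End SparseBlock.

End Blocks.

(** * Components and toughness *)

Section ComponentLabels.
Variables (G : sgraph) (S : {set G}).

Local Notation H := (induced (~: S)).
Local Notation sym_c := (sym_connect_sym (@adj_sym H)).

Definition component : finType := {x : H | fingraph.roots (@adj H) x}.

Definition component_of (x : H) : component :=
  Sub (fingraph.root (@adj H) x) (roots_root sym_c x).

Definition component_label (x : G) : option component :=
  omap component_of (insub x : option H).

Lemma card_component : #|component| = num_comp_del S.
Proof.
rewrite card_sig /num_comp_del /num_comp /n_comp_mem; apply: eq_card => x.
by rewrite !inE andbT.
Qed.

Lemma component_label_val (x : H) :
  component_label (val x) = Some (component_of x).
Proof. by rewrite /component_label valK. Qed.

Lemma component_labelP (x : G) (i : component) :
  component_label x = Some i -> exists2 y : H, val y = x & component_of y = i.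
Proof.
by rewrite /component_label; case: insubP => //= y _ y_x [y_i]; exists y.
Qed.

Lemma cutset_component_label : cutset component_label = S.
Proof.
apply/setP => x; rewrite inE /component_label.
case: insubP => [y + _|]; rewrite inE; first by move/negPf->.
by rewrite negbK => ->.
Qed.

Lemma component_block_neq0 i : block component_label i != set0.
Proof.
apply/set0Pn; exists (val (val i)); rewrite inE component_label_val.
apply/eqP; congr Some; apply: val_inj; apply/eqP; exact: (valP i).
Qed.

Lemma adj_component (x y : G) i j :
  adj x y -> component_label x = Some i -> component_label y = Some j -> i = j.
Proof.
move=> xy /component_labelP[a a_x <-] /component_labelP[b b_y <-].
apply: val_inj; apply/eqP; rewrite /= (root_connect sym_c); apply: connect1.
by rewrite /= /induced_adj a_x b_y.
Qed.

End ComponentLabels.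

Lemma toughness_gt (G : sgraph) (t : rat) :
  (forall S : {set G}, (2 <= num_comp_del S)%N ->
     t * (num_comp_del S)%:R < #|S|%:R) ->
  (t%:E < toughness G)%E.
Proof.
move=> many; rewrite /toughness.
elim/big_ind: _ => [|x y t_x t_y|S /andP[_ c_ge2]].
- exact: ltry.
- by rewrite lt_min t_x t_y.
rewrite lte_fin ltr_pdivlMr ?many // ltr0n; exact: leq_trans c_ge2.
Qed.

Theorem theorem1p6 (R : rcfType) (d : nat) (G : sgraph)
    (d_ge3 : (3 <= d)%N)
    (connG : connected G) (nbipG : ~ bipartite G) (regG : regular d G)
    (lambda2_le :
       eigval R G 2 <= (Num.sqrt (1 + 4 * (d%:R - 1) ^+ 2) - 1) / 2) :
  ~ isomorphic G (Gd d) -> (1%:E < toughness G)%E.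
Proof.
move=> not_Gd; apply: toughness_gt => S c_ge2.
rewrite mul1r ltr_nat ltnNge; apply/negP => S_le; apply: not_Gd.
rewrite -card_component in c_ge2 S_le.
have cut_le : (#|cutset (@component_label G S)| <= #|component S|)%N.
  by rewrite cutset_component_label.
have neq0 := @component_block_neq0 G S; have adj_eq := @adj_component G S.
have [i e_le B_ge] :=
  exists_sparse_block regG neq0 adj_eq nbipG cut_le.
exact: (sparse_block_isomorphic regG neq0 adj_eq d_ge3 lambda2_le e_le B_ge
  cut_le connG c_ge2).
Qed.
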